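(* Let $p$ be an odd prime, $a\in\mathbb{Z}_p$ with $a\not\equiv 0,-1\pmod p$. If $\langle a\rangle_p$ is even, then $$\sum_{k=0}^{p-1}\binom ak^2(-1)^k\Big(1-\frac 2ak\Big)\equiv (-1)^{\frac{\langle a\rangle_p}{2}}2^{2\langle a\rangle_p}\frac{a-\langle a\rangle_p}{a\binom{\langle a\rangle_p}{\langle a\rangle_p/2}}\pmod{p^2}.$$ If $\langle a\rangle_p$ is odd, then $$\sum_{k=0}^{p-1}\binom ak^2(-1)^k\Big(1-\frac 2ak\Big)\equiv \frac{a+1}{a}(-1)^{\frac{p-\langle a\rangle_p}{2}}2^{2\langle a\rangle_p+1}\binom{p-2-\langle a\rangle_p}{\frac{p-2-\langle a\rangle_p}{2}}\Big(1-2pq_p(2)+(p+a-\langle a\rangle_p)\big(H_{\langle a\rangle_p+1}-H_{\frac{\langle a\rangle_p+1}{2}}\big)\Big)\pmod{p^2}.$$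
   Context: $\mathbb{Z}_p$ denotes the set of rational numbers whose denominator is not divisible by $p$; congruences are taken in $\mathbb{Z}_p$. For $a\in\mathbb{Z}_p$, $\langle a\rangle_p$ is the unique integer in $\{0,1,\dots,p-1\}$ with $a\equiv\langle a\rangle_p\pmod p$. The general binomial coefficient is $\binom a0=1$, $\binom ak=a(a-1)\cdots(a-k+1)/k!$ for $k\ge1$. $q_p(2)=(2^{p-1}-1)/p$. $H_0=0$ and $H_n=1+\frac12+\cdots+\frac1n$ for $n\ge1$. *)

(* Defs.v *)
From mathcomp Require Import all_boot all_order all_algebra.
From mathcomp Require Import ring.

Set Implicit Arguments.
Unset Strict Implicit.
Unset Printing Implicit Defensive.

Import Order.TTheory GRing.Theory Num.Theory.

Local Open Scope ring_scope.

Definition Zloc (p : nat) : {pred rat} :=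
  [pred x : rat | ~~ (p %| `|denq x|)%N].

(* Congruence of [x] and [y] modulo [m] in the ring [Zloc p]; both sides are
   required to lie in that ring. For [0 < m], the last conjunct says that
   [x - y] is in the ideal [m Zloc p] (see [eqmod_locP]). *)
Definition eqmod_loc (p m : nat) (x y : rat) : bool :=
  [&& x \in Zloc p, y \in Zloc p & (x - y) / m%:R \in Zloc p].

Lemma eqmod_locP (p m : nat) (x y : rat) : (0 < m)%N ->
  reflect [/\ x \in Zloc p, y \in Zloc p &
             exists2 z, z \in Zloc p & x - y = m%:R * z]
          (eqmod_loc p m x y).
Proof.
move=> m_gt0; have m0 : m%:R != 0 :> rat by rewrite pnatr_eq0 -lt0n.
apply: (iffP and3P) => -[hx hy hxy]; split=> //.
  by exists ((x - y) / m%:R) => //; rewrite mulrC divfK.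
by case: hxy => z hz ->; rewrite mulrAC divff // mul1r.
Qed.

(* The default value 0 is irrelevant when [p] is prime and [a] is in [Zloc p],
   see [residueP] and [residue_uniq]. *)
Definition residue (p : nat) (a : rat) : nat :=
  if [pick k : 'I_p | eqmod_loc p p a k%:R] is Some k then val k else 0%N.

Definition gbin (a : rat) (k : nat) : rat :=
  (\prod_(i < k) (a - i%:R)) / (k`!)%:R.

Definition fermat_quotient2 (p : nat) : rat := (2 ^+ p.-1 - 1) / p%:R.

Definition harmonic_number (n : nat) : rat := \sum_(1 <= k < n.+1) k%:R^-1.

Lemma Zloc_frac (p : nat) (n d : int) :
  ~~ (p %| `|d|)%N -> n%:~R / d%:~R \in Zloc p.
Proof.
move=> pd; apply: contra pd => pden; apply: dvdn_trans pden _.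
have [->|d0] := eqVneq d 0; first by rewrite dvdn0.
set x := n%:~R / d%:~R.
have dx0 : (denq x)%:~R != 0 :> rat by rewrite intr_eq0 denq_eq0.
have d0' : d%:~R != 0 :> rat by rewrite intr_eq0.
have E : numq x * d = n * denq x.
  apply/eqP; rewrite -(eqr_int rat) !rmorphM /=.
  by rewrite -(eqr_div _ _ dx0 d0') divq_num_den.
have := dvdn_mull `|n|%N (dvdnn `|denq x|%N).
rewrite -abszM -E abszM Gauss_dvdr //.
by rewrite coprime_sym coprime_num_den.
Qed.

Lemma residueP (p : nat) (a : rat) : prime p -> a \in Zloc p ->
  (residue p a < p)%N /\ eqmod_loc p p a (residue p a)%:R.
Proof.
move=> pp ha; rewrite /residue; case: pickP => [k hk|no] /=; first by split.
have p_gt0 := prime_gt0 pp.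
have p0 : p%:R != 0 :> rat by rewrite pnatr_eq0 -lt0n.
set d := denq a; set n := numq a.
have d0 : d%:~R != 0 :> rat by rewrite intr_eq0 denq_eq0.
have cop : coprimez d p.
  by rewrite coprimezE coprime_sym prime_coprime.
have [[u v] /= uv] := coprimezP _ _ cop.
have p0z : p%:Z != 0 by rewrite eqz_nat -lt0n.
have := modz_ge0 (n * u) p0z; have := ltz_pmod (n * u) (d := p) p_gt0.
have := divz_eq (n * u) p; set q := (_ %/ _)%Z.
case: (_ %% _)%Z => // k e kp _.
have {kp} kp : (k < p)%N by [].
have /negP[] := negbT (no (Ordinal kp)); rewrite /eqmod_loc ha /=.
have p1 : ~~ (p %| `|1%:Z|)%N by rewrite dvdn1 neq_ltn prime_gt1 ?orbT.
apply/andP; split.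
  by have := Zloc_frac k p1; rewrite divr1.
have -> : (a - k%:R) / p%:R = (n * v + q * d)%:~R / d%:~R.
  have E : n - k%:Z * d = p%:Z * (n * v + q * d).
    have -> : k%:Z = n * u - q * p by rewrite e; ring.
    by rewrite -{1}[n]mulr1 -uv; ring.
  rewrite -[a]divq_num_den -/n -/d.
  apply: (mulfI p0); rewrite mulrCA divff // mulr1 mulrA.
  have -> : p%:R * (n * v + q * d)%:~R = (n - k%:Z * d)%:~R :> rat.
    by rewrite E !rmorphM.
  by rewrite rmorphB rmorphM /= mulrBl mulfK.
exact: Zloc_frac.
Qed.

Lemma residue_uniq (p : nat) (a : rat) (k : nat) : prime p ->
  (k < p)%N -> eqmod_loc p p a k%:R -> k = residue p a.
Proof.
move=> pp kp hk; have ha : a \in Zloc p by case/and3P: hk.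
have [rp hr] := residueP pp ha; move: rp hr; move: (residue p a) => r rp hr.
have p_gt0 := prime_gt0 pp.
have diff_dvd (x y : rat) (m : int) : x \in Zloc p -> y \in Zloc p ->
    m%:~R = p%:R * (x - y) -> (p %| `|m|)%N.
  move=> hx hy; rewrite -[x]divq_num_den -[y]divq_num_den => E.
  have x0 : (denq x)%:~R != 0 :> rat by rewrite intr_eq0 denq_eq0.
  have y0 : (denq y)%:~R != 0 :> rat by rewrite intr_eq0 denq_eq0.
  have {}E : m * (denq x * denq y) =
             p%:Z * (numq x * denq y - numq y * denq x).
    apply/eqP; rewrite -(eqr_int rat) !(rmorphM, rmorphB) /= E.
    by apply/eqP; field; rewrite x0 y0.
  have : (p %| `|(m * (denq x * denq y))%R|)%N by rewrite E abszM dvdn_mulr.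
  by rewrite !abszM !Euclid_dvdM // (negPf hx) (negPf hy) !orbF.
have [_ _ [x hx ex]] := eqmod_locP _ _ _ p_gt0 hk.
have [_ _ [y hy ey]] := eqmod_locP _ _ _ p_gt0 hr.
have: (p %| `|(r%:Z - k%:Z)%R|)%N.
  apply: (diff_dvd x y) => //; rewrite mulrBr -ex -ey rmorphB /=.
  by rewrite opprB [RHS]addrC addrA subrK.
wlog le_kr : k r rp kp {hk hr ex ey} / (k <= r)%N.
  move=> W d; have [le|/ltnW le] := leqP k r; first exact: (W k r).
  by apply/esym/(W r k) => //; rewrite distnC.
rewrite distnEl // => /dvdn_leq; have [lt|] := ltnP k r.
  rewrite subn_gt0 => /(_ lt) /leq_trans/(_ (leq_subr _ _)).
  by rewrite leqNgt rp.
by move=> le_rk _; apply/eqP; rewrite eqn_leq le_kr.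
Qed.

(* Main.v *)
(* Put T(a) = sum_{k<p} C(a,k)^2 (-1)^k (a - 2k), which is a times the sum in
   question. Zeilberger's algorithm gives (a-1) T(a) + 4a T(a-2) as a boundary
   term that carries the square of C(a-1,p-1), so it vanishes modulo p^2 unless
   a is congruent to 0 or 1 modulo p. Write a = r + u with u in p Z_p; descending
   by steps of 2 leads to T(u) = u or to T(1+u) = 2(1+u) modulo p^2, since almost
   all of their binomials are divisible by p.
   For r even the factor u makes it enough to know the product of the ratios
   modulo p, where it is 16^(r/2) / C(r,r/2) up to sign. For r odd the product is
   linear in u modulo p^2; expanded around u = -p, its constant term is an exact
   quotient of central binomials and its slope is a difference of harmonic
   numbers. What remains is Morley's congruence C(p-1,(p-1)/2) = (-1)^((p-1)/2)
   4^(p-1) modulo p^2, which follows by summing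
   C(p-1,k) = (-1)^k (1 - p H_k) over k. *)

Require Import Defs.
From HB Require Import structures.
From mathcomp Require Import all_boot all_order all_algebra.
From mathcomp Require Import ring lra zify.

Set Implicit Arguments.
Unset Strict Implicit.
Unset Printing Implicit Defensive.

Import Order.TTheory GRing.Theory Num.Theory.

Local Open Scope ring_scope.

(** * Congruences in the local ring Z_p *)

Section Localization.

Variables (p : nat) (p_prime : prime p).

Lemma pnatr_neq0 : p%:R != 0 :> rat.
Proof. by rewrite pnatr_eq0 -lt0n prime_gt0. Qed.

Lemma Zloc_subring : subring_closed (Zloc p).
Proof.
have dvdM (x y : rat) : x \in Zloc p -> y \in Zloc p ->
    ~~ (p %| `|(denq x * denq y)%R|)%N.
  by move=> hx hy; rewrite abszM Euclid_dvdM // (negPf hx) (negPf hy).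
have nz (x : rat) : (denq x)%:~R != 0 :> rat by rewrite intr_eq0 denq_eq0.
split=> [|x y hx hy|x y hx hy].
- by rewrite inE /= dvdn1 neq_ltn prime_gt1 ?orbT.
- rewrite -[x]divq_num_den -[y]divq_num_den -mulNr addf_div //.
  rewrite -rmorphN -!rmorphM -rmorphD; apply: Zloc_frac; exact: dvdM.
- rewrite -[x]divq_num_den -[y]divq_num_den mulf_div -!rmorphM.
  apply: Zloc_frac; exact: dvdM.
Qed.

HB.instance Definition _ := GRing.isSubringClosed.Build rat (Zloc p) Zloc_subring.

Lemma Zloc_nat n : n%:R \in Zloc p. Proof. exact: rpred_nat. Qed.

(** If p divided the numerator of x, then x / p would still lie in [Zloc p], making x congruent to
    0; so the numerator is a legitimate denominator. *)
Lemma Zloc_inv (x : rat) : x \in Zloc p -> ~~ eqmod_loc p p x 0 ->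
  x^-1 \in Zloc p.
Proof.
move=> hx; rewrite /eqmod_loc hx rpred0 subr0 /= => hxp.
rewrite -[x]divq_num_den invf_div; apply: Zloc_frac.
apply: contra hxp => px; have /dvdzP[k ek] : (p%:Z %| numq x)%Z by [].
rewrite -[x]divq_num_den ek rmorphM /= mulrAC mulfK ?pnatr_neq0 //.
exact: Zloc_frac.
Qed.

Lemma eqmod_loc_refl m x : x \in Zloc p -> eqmod_loc p m x x.
Proof. by move=> hx; rewrite /eqmod_loc hx subrr mul0r rpred0. Qed.

Lemma eqmod_loc_sym m x y : eqmod_loc p m x y -> eqmod_loc p m y x.
Proof.
by case/and3P=> hx hy h; rewrite /eqmod_loc hx hy -opprB mulNr rpredN.
Qed.

Lemma eqmod_loc_trans m y x z :
  eqmod_loc p m x y -> eqmod_loc p m y z -> eqmod_loc p m x z.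
Proof.
case/and3P=> hx _ h /and3P[_ hz h']; rewrite /eqmod_loc hx hz /=.
by have -> : x - z = x - y + (y - z) by [ring]; rewrite mulrDl rpredD.
Qed.

Lemma eqmod_locD m x y x' y' : eqmod_loc p m x y -> eqmod_loc p m x' y' ->
  eqmod_loc p m (x + x') (y + y').
Proof.
case/and3P=> hx hy h /and3P[hx' hy' h']; rewrite /eqmod_loc !rpredD //=.
by rewrite opprD addrACA mulrDl rpredD.
Qed.

Lemma eqmod_locM m x y x' y' : eqmod_loc p m x y -> eqmod_loc p m x' y' ->
  eqmod_loc p m (x * x') (y * y').
Proof.
case/and3P=> hx hy h /and3P[hx' hy' h']; rewrite /eqmod_loc rpredM // rpredM //=.
have -> : (x * x' - y * y') / m%:R = (x - y) / m%:R * x' + y * ((x' - y') / m%:R).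
  by ring.
by rewrite rpredD // rpredM.
Qed.

Lemma eqmod_loc_sum m (I : Type) (r : seq I) (P : pred I) (E E' : I -> rat) :
  (forall i, P i -> eqmod_loc p m (E i) (E' i)) ->
  eqmod_loc p m (\sum_(i <- r | P i) E i) (\sum_(i <- r | P i) E' i).
Proof.
move=> h; elim/big_rec2: _ => [|i x y Pi]; first exact/eqmod_loc_refl/rpred0.
by apply: eqmod_locD; exact: h.
Qed.

Lemma eqmod_loc_diff m x y z : x \in Zloc p -> y \in Zloc p -> (0 < m)%N ->
  z \in Zloc p -> x - y = m%:R * z -> eqmod_loc p m x y.
Proof. by move=> hx hy m0 hz e; apply/eqmod_locP => //; split=> //; exists z. Qed.

Lemma eqmod_loc_inv (x : rat) (k : nat) : eqmod_loc p p x k%:R ->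
  (0 < k < p)%N -> (x != 0) * (x^-1 \in Zloc p).
Proof.
move=> h /andP[k0 kp]; have hx : x \in Zloc p by case/and3P: h.
have nz : ~~ eqmod_loc p p x 0.
  apply/negP => h0.
  have := residue_uniq p_prime (prime_gt0 p_prime) h0.
  by rewrite -(residue_uniq p_prime kp h) => k0'; rewrite -k0' in k0.
split; last exact: Zloc_inv.
by apply: contraNneq nz => ->; apply/eqmod_loc_refl/rpred0.
Qed.

Lemma Zloc_natV k : (0 < k < p)%N -> k%:R^-1 \in Zloc p.
Proof.
by move=> kp; have [_ ->] := eqmod_loc_inv (eqmod_loc_refl p (Zloc_nat k)) kp.
Qed.

(** This is how error terms modulo p^2 are discarded below: each is displayed as two multiples of p
    times a p-integral cofactor. *)
Lemma eqmod_loc0M2 x y z : eqmod_loc p p x 0 -> eqmod_loc p p y 0 ->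
  z \in Zloc p -> eqmod_loc p (p ^ 2) (x * y * z) 0.
Proof.
move=> /(eqmod_locP _ _ _ (prime_gt0 p_prime))[hx _ [x' hx' ex]].
move=> /(eqmod_locP _ _ _ (prime_gt0 p_prime))[hy _ [y' hy' ey]] hz.
apply: (@eqmod_loc_diff _ _ _ (x' * y' * z)); rewrite ?rpredM ?rpred0 //.
  by rewrite expn_gt0 prime_gt0.
rewrite subr0 in ex; rewrite subr0 in ey.
by rewrite ex ey natrX; ring.
Qed.

(** * Generalized binomial coefficients modulo p *)

Lemma gbinS a k : gbin a k.+1 = gbin a k * (a - k%:R) / k.+1%:R.
Proof.
rewrite /gbin big_ord_recr /= factS natrM; field.
by rewrite !pnatr_eq0 -!lt0n fact_gt0 nat1r pnatr_eq0.
Qed.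

Lemma gbin0 a : gbin a 0 = 1.
Proof. by rewrite /gbin big_ord0 divr1. Qed.

Lemma gbin_absorb b k : gbin (b + 1) k.+1 = (b + 1) / k.+1%:R * gbin b k.
Proof.
elim: k => [|k IH]; first by rewrite gbinS !gbin0; field.
rewrite gbinS IH [in RHS]gbinS -!natr1; field.
by rewrite !natr1 !pnatr_eq0.
Qed.

Lemma gbin_shift b k : (b + 1) * gbin b k = (b + 1 - k%:R) * gbin (b + 1) k.
Proof.
have k0 : k.+1%:R != 0 :> rat by rewrite pnatr_eq0.
have := gbin_absorb b k; rewrite gbinS => e.
apply: (mulIf (invr_neq0 k0)); rewrite mulrAC -e; ring.
Qed.

Lemma Zloc_gbin a k : a \in Zloc p -> (k < p)%N -> gbin a k \in Zloc p.
Proof.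
move=> ha; elim: k => [|k IH] kp; first by rewrite gbin0 rpred1.
rewrite gbinS rpredM ?Zloc_natV ?kp // rpredM ?IH 1?ltnW //.
by rewrite rpredB ?Zloc_nat.
Qed.

(** For k > j the numerator contains the factor a - j, a multiple of p, while k! is prime to p. The
    induction meets this factor at the step from j to j + 1. *)
Lemma gbin_eq0 a j k : eqmod_loc p p a j%:R -> (j < k < p)%N ->
  eqmod_loc p p (gbin a k) 0.
Proof.
move=> haj; have ha : a \in Zloc p by case/and3P: haj.
elim: k => // k IH /andP[jk kp]; rewrite gbinS -mulrA.
have hk : (a - k%:R) / k.+1%:R \in Zloc p.
  by rewrite rpredM ?Zloc_natV ?kp // rpredB ?Zloc_nat.
have [jk'|kj] := ltnP j k.
  have h : eqmod_loc p p (gbin a k) 0 by apply: IH; rewrite jk' ltnW.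
  by have := eqmod_locM h (eqmod_loc_refl p hk); rewrite mul0r.
have -> : k = j by lia.
suff: eqmod_loc p p (gbin a j * ((a - j%:R) / j.+1%:R)) (gbin a j * (0 / j.+1%:R)).
  by rewrite mul0r mulr0.
apply: eqmod_locM; first by apply: eqmod_loc_refl; apply: Zloc_gbin => //; lia.
apply: eqmod_locM.
  rewrite -(subrr j%:R); apply: eqmod_locD => //.
  by apply: eqmod_loc_refl; rewrite rpredN Zloc_nat.
by apply: eqmod_loc_refl; apply: Zloc_natV; lia.
Qed.

(** * The alternating sum: recurrence in steps of two and initial values *)

Definition alt_term (a : rat) (k : nat) : rat :=
  gbin a k ^+ 2 * (-1) ^+ k * (a - 2 * k%:R).

(* [a] times the sum of the theorem, without the division by [a] that is
   meaningless at [a = 0] *)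
Definition alt_sum a := \sum_(0 <= k < p) alt_term a k.

(* The cubic in [n] is the certificate of Zeilberger's algorithm. *)
Lemma alt_sum_telescope b n : b + 1 != 0 ->
  \sum_(0 <= k < n.+1) ((b + 1) * alt_term (b + 2) k +
                          4 * (b + 2) * alt_term b k)
  = (-1) ^+ n * gbin (b + 1) n ^+ 2 * ((b + 2) *
     (- 4 * n%:R ^+ 3 + (14 * b + 10) * n%:R ^+ 2 - 8 * (2 * b + 1) * (b + 1) * n%:R
      + (b + 1) ^+ 2 * (5 * b + 1))) / (b + 1) ^+ 2.
Proof.
move=> b0; elim: n => [|n IH].
  by rewrite big_nat1 /alt_term !gbin0 !expr0; field.
rewrite big_nat_recr //= IH /alt_term.
have -> : b + 2 = b + 1 + 1 by ring.
rewrite gbin_absorb.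
(* All binomials are expressed through C(b+1, n), which turns the induction step into an identity of
   rational functions in b and n. *)
have e : gbin b n = (b + 1 - n%:R) * gbin (b + 1) n / (b + 1).
  by rewrite -gbin_shift; field.
rewrite (gbinS b) e (gbinS (b + 1)) !exprS -!natr1.
have n0 : n%:R + 1 != 0 :> rat by rewrite natr1 pnatr_eq0.
by field; rewrite b0 n0.
Qed.

Ltac Zloc_tac :=
  repeat match goal with
  | |- is_true (_ * _ \in _) => apply: rpredM
  | |- is_true (_ + _ \in _) => apply: rpredD
  | |- is_true (- _ \in _) => rewrite rpredN
  | |- is_true (_ ^+ _ \in _) => apply: rpredX
  | |- is_true (1 \in _) => exact: rpred1
  | |- is_true (0 \in _) => exact: rpred0
  | |- is_true (_%:R \in _) => exact: Zloc_nat
  | _ => done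
  end.

Lemma eqmod_loc_sub0 m x y : x \in Zloc p -> y \in Zloc p ->
  eqmod_loc p m (x - y) 0 -> eqmod_loc p m x y.
Proof.
by move=> hx hy; rewrite /eqmod_loc hx hy subr0 => /and3P[_ _ ->].
Qed.

Lemma eqmod_locB m x y x' y' : eqmod_loc p m x y -> eqmod_loc p m x' y' ->
  eqmod_loc p m (x - x') (y - y').
Proof.
move=> h h'; apply: eqmod_locD => //; case/and3P: h' => hx hy h'.
by rewrite /eqmod_loc !rpredN hx hy -opprD mulNr rpredN.
Qed.

Lemma Zloc_alt_term a k : a \in Zloc p -> (k < p)%N -> alt_term a k \in Zloc p.
Proof.
move=> ha kp; rewrite /alt_term; Zloc_tac; exact: Zloc_gbin.
Qed.

Lemma Zloc_alt_sum a : a \in Zloc p -> alt_sum a \in Zloc p.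
Proof.
move=> ha; rewrite /alt_sum big_mkord; apply: rpred_sum => k _.
exact: Zloc_alt_term.
Qed.

(** The telescoped identity is taken at b = a - 2 and n = p - 1. Since a - 1 has residue j - 1 with
    0 < j - 1 < p - 1, it is a unit, and C(a-1, p-1) is divisible by p, so its square kills the
    boundary term. *)
Lemma alt_sum_rec a j : eqmod_loc p p a j%:R -> (1 < j < p)%N ->
  eqmod_loc p (p ^ 2) (alt_sum a) (- 4 * (a / (a - 1)) * alt_sum (a - 2)).
Proof.
move=> haj jp; have ha : a \in Zloc p by case/and3P: haj.
have j1 : eqmod_loc p p (a - 1) j.-1%:R.
  have -> : j.-1%:R = j%:R - 1 :> rat by rewrite -subn1 natrB //; lia.
  exact/eqmod_locB/eqmod_loc_refl/rpred1.
have [a1 iz] := eqmod_loc_inv j1 (ltac:(lia) : (0 < j.-1 < p)%N).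
have g0 : eqmod_loc p p (gbin (a - 1) p.-1) 0.
  by apply: (gbin_eq0 j1); lia.
apply: eqmod_loc_sub0.
- exact: Zloc_alt_sum.
- have ? := Zloc_alt_sum (rpredB ha (Zloc_nat 2)); Zloc_tac.
have := @alt_sum_telescope (a - 2) p.-1.
have -> : a - 2 + 1 = a - 1 by ring.
have -> : a - 2 + 2 = a by ring.
rewrite prednK ?prime_gt0 // => /(_ a1).
rewrite big_split /= -!mulr_sumr -/(alt_sum a) -/(alt_sum (a - 2)).
move: (gbin _ _) g0 => g g0 e.
have -> : alt_sum a - - 4 * (a / (a - 1)) * alt_sum (a - 2) =
  ((a - 1) * alt_sum a + 4 * a * alt_sum (a - 2)) / (a - 1) by field.
rewrite e; set q := (X in _ ^+ _ * g ^+ 2 * X / _).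
have -> : (-1) ^+ p.-1 * g ^+ 2 * q / (a - 1) ^+ 2 / (a - 1) =
  g * g * ((-1) ^+ p.-1 * q * (a - 1)^-1 ^+ 3) by field.
apply: eqmod_loc0M2 => //.
by rewrite /q; Zloc_tac.
Qed.

Lemma eqmod_locDnat c (c0 : nat) j :
  eqmod_loc p p c c0%:R -> eqmod_loc p p (c + j%:R) (c0 + j)%:R.
Proof. by move=> h; rewrite natrD; apply/eqmod_locD/eqmod_loc_refl/Zloc_nat. Qed.

Lemma alt_sum_iter c (c0 n : nat) : eqmod_loc p p c c0%:R ->
  (c0 + n.*2 < p)%N ->
  eqmod_loc p (p ^ 2) (alt_sum (c + n.*2%:R))
   ((- 4) ^+ n * \prod_(i < n) ((c + i.*2.+2%:R) / (c + i.*2.+1%:R)) * alt_sum c).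
Proof.
move=> hc; have cZ : c \in Zloc p by case/and3P: hc.
elim: n => [|n IH] cp.
  by rewrite expr0 big_ord0 !mul1r addr0; apply/eqmod_loc_refl/Zloc_alt_sum.
apply: eqmod_loc_trans (alt_sum_rec (eqmod_locDnat _ hc) _) _; first by lia.
have -> : c + n.+1.*2%:R - 2 = c + n.*2%:R by rewrite doubleS -!natr1; ring.
have -> : c + n.+1.*2%:R - 1 = c + n.*2.+1%:R by rewrite doubleS -!natr1; ring.
rewrite exprS big_ord_recr doubleS /=; set x := c + _; set y := c + _.
set P := \prod_(i < n) _; set A := alt_sum c.
have -> : - 4 * (- 4) ^+ n * (P * (x / y)) * A =
  - 4 * (x / y) * ((- 4) ^+ n * P * A) by ring.
apply: eqmod_locM; last by apply: IH; lia.
have jp : (0 < c0 + n.*2.+1 < p)%N by lia.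
have [_ yZ] := eqmod_loc_inv (eqmod_locDnat n.*2.+1 hc) jp.
by rewrite /x; apply: eqmod_loc_refl; Zloc_tac.
Qed.

(** Binomials enter squared, so a tail of binomials divisible by p vanishes modulo p^2. *)
Lemma alt_sum_gbin_small c m : c \in Zloc p -> (m <= p)%N ->
  (forall k, (m <= k < p)%N -> eqmod_loc p p (gbin c k) 0) ->
  eqmod_loc p (p ^ 2) (alt_sum c) (\sum_(0 <= k < m) alt_term c k).
Proof.
move=> hc mp h; rewrite /alt_sum (big_cat_nat (leq0n m) mp) /=.
rewrite -[X in eqmod_loc _ _ _ X]addr0; apply: eqmod_locD.
  apply/eqmod_loc_refl; rewrite big_mkord rpred_sum // => k _.
  exact/Zloc_alt_term/(leq_trans _ mp).
have e : \sum_(m <= k < p) (0 : rat) = 0 by rewrite big1.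
rewrite -[X in eqmod_loc _ _ _ X]e !big_nat; apply: eqmod_loc_sum => k /h hk.
rewrite /alt_term expr2 -mulrA; apply: eqmod_loc0M2 => //.
Zloc_tac.
Qed.

Lemma alt_sum0 u : eqmod_loc p p u 0 -> eqmod_loc p (p ^ 2) (alt_sum u) u.
Proof.
move=> hu; have uZ : u \in Zloc p by case/and3P: hu.
have e : \sum_(0 <= k < 1) alt_term u k = u.
  by rewrite big_nat1 /alt_term gbin0 expr0; ring.
rewrite -[X in eqmod_loc _ _ _ X]e; apply: alt_sum_gbin_small => //.
  exact: prime_gt0.
by move=> k /andP[k0 kp]; apply: (@gbin_eq0 u 0%N) => //; rewrite k0.
Qed.

Lemma alt_sum1 u : eqmod_loc p p u 0 ->
  eqmod_loc p (p ^ 2) (alt_sum (1 + u)) (2 * (1 + u)).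
Proof.
move=> hu; have uZ : u \in Zloc p by case/and3P: hu.
have h1 : eqmod_loc p p (1 + u) 1%:R.
  rewrite -[X in eqmod_loc _ _ _ X]addr0; apply/eqmod_locD => //.
  exact/eqmod_loc_refl/rpred1.
(* Only k = 0 and k = 1 survive; their terms are 1 + u and (1 + u)^2 (1 - u). *)
have e : \sum_(0 <= k < 2) alt_term (1 + u) k = 2 * (1 + u) - u * u * (1 + u).
  rewrite big_nat_recr //= big_nat1 /alt_term gbinS gbin0 expr0; by field.
have h2 : eqmod_loc p (p ^ 2) (alt_sum (1 + u))
    (\sum_(0 <= k < 2) alt_term (1 + u) k).
  apply: alt_sum_gbin_small; first by rewrite rpredD ?rpred1.
    exact: prime_gt1.
  by move=> k /andP[k0 kp]; apply: (gbin_eq0 h1); rewrite k0.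
apply: eqmod_loc_trans h2 _.
rewrite e -[X in eqmod_loc _ _ _ X]subr0; apply: eqmod_locB.
  by apply/eqmod_loc_refl; Zloc_tac.
by apply: eqmod_loc0M2 => //; rewrite rpredD ?rpred1.
Qed.

(** * Even residues: the product of the ratios modulo p *)

Lemma eqmod_loc_prod m (I : Type) (r : seq I) (P : pred I) (E E' : I -> rat) :
  (forall i, P i -> eqmod_loc p m (E i) (E' i)) ->
  eqmod_loc p m (\prod_(i <- r | P i) E i) (\prod_(i <- r | P i) E' i).
Proof.
move=> h; elim/big_rec2: _ => [|i x y Pi]; first exact/eqmod_loc_refl/rpred1.
by apply: eqmod_locM; exact: h.
Qed.

Lemma eqmod_locV x k : eqmod_loc p p x k%:R -> (0 < k < p)%N ->
  eqmod_loc p p x^-1 k%:R^-1.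
Proof.
move=> h kp; have [x0 xZ] := eqmod_loc_inv h kp.
have [k0 kZ] := eqmod_loc_inv (eqmod_loc_refl p (Zloc_nat k)) kp.
have hZ : x^-1 * k%:R^-1 \in Zloc p by apply: rpredM.
have := eqmod_locM (eqmod_loc_refl p hZ) (eqmod_loc_sym h).
by rewrite divfK // mulrAC mulVf // mul1r.
Qed.

(** A factor divisible by p lifts a congruence from modulus p to p^2; in the even case this factor
    is u. *)
Lemma eqmod_locM0 x y y' : eqmod_loc p p x 0 -> eqmod_loc p p y y' ->
  eqmod_loc p (p ^ 2) (y * x) (y' * x).
Proof.
move=> hx hy; have xZ : x \in Zloc p by case/and3P: hx.
have [yZ yZ' _] := and3P hy.
apply: eqmod_loc_sub0; rewrite ?rpredM // -mulrBl -[X in eqmod_loc _ _ X]mulr1.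
apply: eqmod_loc0M2; rewrite ?rpred1 //.
by rewrite -(subrr y'); apply: eqmod_locB => //; exact: eqmod_loc_refl.
Qed.

Lemma central_binS n :
  'C(n.+1.*2, n.+1)%:R = 2 * (n.*2.+1)%:R / n.+1%:R * 'C(n.*2, n)%:R :> rat.
Proof.
have n0 : n.+1%:R != 0 :> rat by rewrite pnatr_eq0.
have e1 : (n.+1 * 'C(n.+1.*2, n.+1) = n.+1.*2 * 'C(n.*2.+1, n))%N.
  by rewrite -mul_bin_diag doubleS.
have e2 : (n.+1 * 'C(n.*2.+1, n) = n.*2.+1 * 'C(n.*2, n))%N.
  have -> : 'C(n.*2.+1, n) = 'C(n.*2.+1, n.+1)
    by rewrite -bin_sub; [congr 'C(_, _)|]; lia.
  by rewrite -mul_bin_diag.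
have {}e1 : 'C(n.+1.*2, n.+1) = (2 * 'C(n.*2.+1, n))%N by nia.
have /(congr1 (fun k => k%:R : rat)) := e2; rewrite e1 !natrM => {}e2.
apply: (mulfI n0); rewrite mulrCA e2; field.
by rewrite nat1r.
Qed.

Lemma central_bin_neq0 n : 'C(n.*2, n)%:R != 0 :> rat.
Proof. by rewrite pnatr_eq0 -lt0n bin_gt0; lia. Qed.

(** A partial Wallis product. *)
Lemma prod_even_odd n :
  \prod_(i < n) (i.*2.+2%:R / i.*2.+1%:R) = 4 ^+ n / 'C(n.*2, n)%:R :> rat.
Proof.
elim: n => [|n IH]; first by rewrite big_ord0 expr0 bin0 divr1.
rewrite big_ord_recr /= IH central_binS exprS -[n.*2.+2]/(n.+1.*2).
have h0 := central_bin_neq0 n.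
rewrite -!mul2n -[(2 * n).+1]addn1 -addn1 !(natrM, natrD) in h0 *; field.
have n0 : 0 <= n%:R :> rat by rewrite ler0n.
by rewrite h0 !lt0r_neq0 //; lra.
Qed.

(** The descent ends at [alt_sum u], congruent to u. As u is a multiple of p, it may be dropped from
    every ratio, which leaves the Wallis product; (-4)^n 4^n gives the sign and the power of 2. *)
Lemma alt_sum_even u n : eqmod_loc p p u 0 -> (n.*2 < p)%N ->
  eqmod_loc p (p ^ 2) (alt_sum (u + n.*2%:R))
    ((-1) ^+ n * 2 ^+ (4 * n) * (u / 'C(n.*2, n)%:R)).
Proof.
move=> hu np; have hu0 : eqmod_loc p p u 0%:R by [].
apply: eqmod_loc_trans (alt_sum_iter hu0 np) _.
have hP : eqmod_loc p p
   ((- 4) ^+ n * \prod_(i < n) ((u + i.*2.+2%:R) / (u + i.*2.+1%:R)))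
   ((- 4) ^+ n * \prod_(i < n) (i.*2.+2%:R / i.*2.+1%:R)).
  apply: eqmod_locM; first by apply: eqmod_loc_refl; Zloc_tac.
  apply: eqmod_loc_prod => i _; apply: eqmod_locM; first exact: (eqmod_locDnat _ hu0).
  apply: eqmod_locV; first exact: (eqmod_locDnat _ hu0).
  by have := ltn_ord i; lia.
have hA := eqmod_locM (eqmod_loc_refl (p ^ 2) (proj1 (andP hP))) (alt_sum0 hu).
apply: eqmod_loc_trans hA _.
have -> : (-1) ^+ n * 2 ^+ (4 * n) * (u / 'C(n.*2, n)%:R) =
  (- 4) ^+ n * \prod_(i < n) (i.*2.+2%:R / i.*2.+1%:R) * u.
  rewrite prod_even_odd exprM.
  have -> : 2 ^+ 4 = 4 * 4 :> rat by ring.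
  rewrite -[- 4]mulN1r !exprMn; field; exact: central_bin_neq0.
exact: eqmod_locM0.
Qed.

(** * Harmonic numbers, 2^(p-1) and Morley's congruence *)

Lemma harmonic_numberS n :
  harmonic_number n.+1 = harmonic_number n + n.+1%:R^-1.
Proof. by rewrite /harmonic_number big_nat_recr. Qed.

Lemma harmonic_number0 : harmonic_number 0 = 0.
Proof. by rewrite /harmonic_number big_geq. Qed.

Lemma Zloc_harmonic n : (n < p)%N -> harmonic_number n \in Zloc p.
Proof.
elim: n => [|n IH] np; first by rewrite harmonic_number0 rpred0.
by rewrite harmonic_numberS rpredD ?IH ?(ltnW np) // Zloc_natV.
Qed.

Lemma eqmod_loc_p0 : eqmod_loc p p p%:R 0.
Proof.
by rewrite /eqmod_loc Zloc_nat rpred0 subr0 divff ?rpred1 ?pnatr_neq0.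
Qed.

(** Induction on C(p-1, k+1) = C(p-1, k) (p/(k+1) - 1), dropping the term in p^2. *)
Lemma bin_pred_prime k : (k < p)%N ->
  eqmod_loc p (p ^ 2) 'C(p.-1, k)%:R ((-1) ^+ k * (1 - p%:R * harmonic_number k)).
Proof.
elim: k => [|k IH] kp.
  rewrite bin0 harmonic_number0 mulr0 subr0 mulr1 expr0.
  exact/eqmod_loc_refl/rpred1.
have k0 : k.+1%:R != 0 :> rat by rewrite pnatr_eq0.
have kZ : k.+1%:R^-1 \in Zloc p by rewrite Zloc_natV ?kp.
have HZ := Zloc_harmonic (ltnW kp).
have e : 'C(p.-1, k.+1)%:R = 'C(p.-1, k)%:R * (p%:R / k.+1%:R - 1) :> rat.
  apply: (mulfI k0); rewrite -natrM mul_bin_left natrM natrB; last by lia.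
  rewrite -subn1 natrB ?prime_gt0 //; rewrite -natr1 in k0 *; field.
  exact: k0.
rewrite e; apply: eqmod_loc_trans (eqmod_locM (IH (ltnW kp)) (eqmod_loc_refl _ _)) _.
  Zloc_tac.
apply: eqmod_loc_sub0; [Zloc_tac | rewrite harmonic_numberS; Zloc_tac |].
rewrite harmonic_numberS exprS; set H := harmonic_number k.
have -> : (-1) ^+ k * (1 - p%:R * H) * (p%:R / k.+1%:R - 1) -
  -1 * (-1) ^+ k * (1 - p%:R * (H + k.+1%:R^-1)) =
  p%:R * p%:R * (- ((-1) ^+ k * H / k.+1%:R)) by ring.
apply: eqmod_loc0M2; try exact: eqmod_loc_p0.
by rewrite /H; Zloc_tac.
Qed.

(** The terms of index 2h+1 and 2h+2 together contribute -x/(2h+2), half of the new term of -x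
    H_(h+1). *)
Lemma alt_harmonic_sum (x : rat) h :
  \sum_(0 <= k < h.*2.+1) (-1) ^+ k * (1 - x * harmonic_number k) =
  1 - x * harmonic_number h / 2.
Proof.
elim: h => [|h IH]; first by rewrite big_nat1 expr0 harmonic_number0; ring.
rewrite doubleS big_nat_recr //= big_nat_recr //= IH !harmonic_numberS.
rewrite !exprS -[h.*2.+2]/(h.+1.*2) -!mul2n exprM sqrrN !expr1n natrM.
have h0 : 0 <= h%:R :> rat by rewrite ler0n.
by field; rewrite !lt0r_neq0 //; lra.
Qed.

Variable h : nat.
Hypothesis pE : p = h.*2.+1.

(** Here h = (p-1)/2. Expand (1 + 1)^(p-1), replace each C(p-1, k) by its value modulo p^2 and
    sum. *)
Lemma pow2_pred_prime :
  eqmod_loc p (p ^ 2) (2 ^+ p.-1) (1 - p%:R * harmonic_number h / 2).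
Proof.
rewrite -alt_harmonic_sum -pE.
have -> : 2 ^+ p.-1 = \sum_(0 <= k < p) 'C(p.-1, k)%:R :> rat.
  rewrite -natrX -[2%N]/(1 + 1)%N expnDn natr_sum.
  rewrite -[in RHS](prednK (prime_gt0 p_prime)) big_mkord; apply: eq_bigr => k _.
  by rewrite !exp1n !muln1.
rewrite !big_nat; apply: eqmod_loc_sum => k /andP[_ kp]; exact: bin_pred_prime.
Qed.

Lemma Zloc_half : 2^-1 \in Zloc p.
Proof. by apply: (@Zloc_natV 2); have := prime_gt1 p_prime; lia. Qed.

Lemma Zloc_fermat_quotient2 : fermat_quotient2 p \in Zloc p.
Proof.
have p20 : (0 < p ^ 2)%N by rewrite expn_gt0 prime_gt0.
have [_ _ [z zZ e]] := eqmod_locP _ _ _ p20 pow2_pred_prime.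
have HZ := @Zloc_harmonic h (ltac:(lia)); have hZ := Zloc_half.
(* The congruence for 2^(p-1) divided by p. *)
have -> : fermat_quotient2 p = p%:R * z - harmonic_number h / 2.
  rewrite /fermat_quotient2 -[2 ^+ _](subrK (1 - p%:R * harmonic_number h / 2)).
  by rewrite e natrX; field; exact: pnatr_neq0.
Zloc_tac.
Qed.

Lemma pow4_half : 4 ^+ h = 1 + p%:R * fermat_quotient2 p :> rat.
Proof.
have e4 : 2 ^+ p.-1 = 4 ^+ h :> rat.
  by rewrite pE /= -mul2n exprM; congr (_ ^+ _); ring.
by rewrite /fermat_quotient2 e4; field; exact: pnatr_neq0.
Qed.

(* Morley's congruence, which actually holds modulo p ^ 3 *)
Lemma central_bin_pred_prime :
  eqmod_loc p (p ^ 2) 'C(h.*2, h)%:R ((-1) ^+ h * (4 ^+ h) ^+ 2).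
Proof.
have HZ := @Zloc_harmonic h (ltac:(lia)); have hZ := Zloc_half.
have hp : (h < p)%N by lia.
have h1 := bin_pred_prime hp; have h2 := pow2_pred_prime.
have e4 : 4 ^+ h = 2 ^+ p.-1 :> rat.
  by rewrite pE /= -mul2n exprM; congr (_ ^+ _); ring.
rewrite e4; have pe : p.-1 = h.*2 by rewrite pE.
rewrite -pe.
(* Apart from the sign, both sides are 1 - p H_h modulo p^2: the left by the formula for C(p-1, h),
   the right as the square of 1 - p H_h / 2. *)
apply: eqmod_loc_trans h1 _; apply: eqmod_locM; first by apply: eqmod_loc_refl; Zloc_tac.
apply: eqmod_loc_sym; rewrite expr2; apply: eqmod_loc_trans (eqmod_locM h2 h2) _.
apply: eqmod_loc_sub0; try Zloc_tac.
set H := harmonic_number h.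
have -> : (1 - p%:R * H / 2) * (1 - p%:R * H / 2) - (1 - p%:R * H) =
  p%:R * p%:R * (H * H / 2 / 2) by field.
by apply: eqmod_loc0M2; try exact: eqmod_loc_p0; rewrite /H; Zloc_tac.
Qed.

(** * Odd residues: linear expansion of the product around u = -p *)

Lemma eqmod_loc_subp j : eqmod_loc p p (j%:R - p%:R) j%:R.
Proof.
rewrite -[X in eqmod_loc _ _ _ X]subr0; apply: eqmod_locB; last exact: eqmod_loc_p0.
exact/eqmod_loc_refl/Zloc_nat.
Qed.

(** With v = u + p the new factor is j + u, that is (j - p)(1 + v/(j - p)). Modulo p^2, v/(j - p) is
    v/j, so the slopes simply add. *)
Lemma eqmod_lin_mul X Y v E j : eqmod_loc p p v 0 -> E \in Zloc p ->
  (0 < j < p)%N -> eqmod_loc p (p ^ 2) X (Y * (1 + v * E)) -> Y \in Zloc p ->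
  eqmod_loc p (p ^ 2) (X * (j%:R - p%:R + v))
    (Y * (j%:R - p%:R) * (1 + v * (E + j%:R^-1))).
Proof.
move=> hv EZ jp hX YZ; have vZ : v \in Zloc p by case/and3P: hv.
have j0 : j%:R != 0 :> rat by rewrite pnatr_eq0; lia.
have jZ := Zloc_natV jp.
have cZ : j%:R - p%:R + v \in Zloc p by Zloc_tac.
apply: eqmod_loc_trans (eqmod_locM hX (eqmod_loc_refl _ cZ)) _.
apply: eqmod_loc_sub0; try Zloc_tac.
have -> : Y * (1 + v * E) * (j%:R - p%:R + v) -
   Y * (j%:R - p%:R) * (1 + v * (E + j%:R^-1)) =
   v * v * (Y * E) + p%:R * v * (Y / j%:R) by field.
rewrite -[X in eqmod_loc _ _ _ X]addr0; apply: eqmod_locD; apply: eqmod_loc0M2;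
  try Zloc_tac; exact: eqmod_loc_p0.
Qed.

Lemma eqmod_lin_div X Y v E j : eqmod_loc p p v 0 -> E \in Zloc p ->
  (0 < j < p)%N -> eqmod_loc p (p ^ 2) X (Y * (1 + v * E)) -> Y \in Zloc p ->
  eqmod_loc p (p ^ 2) (X / (j%:R - p%:R + v))
    (Y / (j%:R - p%:R) * (1 + v * (E - j%:R^-1))).
Proof.
move=> hv EZ jp hX YZ; have vZ : v \in Zloc p by case/and3P: hv.
have j0 : j%:R != 0 :> rat by rewrite pnatr_eq0; lia.
have jZ := Zloc_natV jp.
have hc := eqmod_loc_subp j.
have hcv : eqmod_loc p p (j%:R - p%:R + v) j%:R.
  by rewrite -[X in eqmod_loc _ _ _ X]addr0; apply: eqmod_locD.
have [c0 cZ] := eqmod_loc_inv hc jp; have [cv0 cvZ] := eqmod_loc_inv hcv jp.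
apply: eqmod_loc_trans (eqmod_locM hX (eqmod_loc_refl _ cvZ)) _.
apply: eqmod_loc_sub0; try Zloc_tac.
have -> : Y * (1 + v * E) / (j%:R - p%:R + v) -
   Y / (j%:R - p%:R) * (1 + v * (E - j%:R^-1)) =
   v * v * (Y / (j%:R - p%:R + v) / (j%:R - p%:R) * (j%:R^-1 - E))
   - p%:R * v * (Y / (j%:R - p%:R + v) / (j%:R - p%:R) / j%:R).
  by field; rewrite j0 c0 cv0.
rewrite -[X in eqmod_loc _ _ _ X]subr0; apply: eqmod_locB; apply: eqmod_loc0M2;
  try Zloc_tac; exact: eqmod_loc_p0.
Qed.

(** The quotient of (1+u)(3+u)...(2n+1+u) by (2+u)(4+u)...(2n+u): the ratios met in the descent to 1
    + u, together with the factor 1 + u of the final value. *)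
Definition odd_even_prod (u : rat) (n : nat) : rat :=
  (1 + u) * \prod_(i < n) ((1 + u + i.*2.+2%:R) / (1 + u + i.*2.+1%:R)).

Lemma odd_even_prodS u n : odd_even_prod u n.+1 =
  odd_even_prod u n / (n.*2.+2%:R + u) * (n.*2.+3%:R + u).
Proof.
rewrite /odd_even_prod big_ord_recr /=.
have e k : 1 + u + k%:R = k.+1%:R + u by rewrite -nat1r; ring.
rewrite !e; ring.
Qed.

Lemma Zloc_odd_even_prod u n : eqmod_loc p p u 0 -> (n.*2.+1 < p)%N ->
  odd_even_prod u n \in Zloc p.
Proof.
move=> hu; have uZ : u \in Zloc p by case/and3P: hu.
elim: n => [|n IH] np; first by rewrite /odd_even_prod big_ord0 mulr1; Zloc_tac.
have h2 : eqmod_loc p p (n.*2.+2%:R + u) n.*2.+2%:R.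
  rewrite -[X in eqmod_loc _ _ _ X]addr0; apply: eqmod_locD => //.
  exact/eqmod_loc_refl/Zloc_nat.
have [_ h2Z] := eqmod_loc_inv h2 (ltac:(lia) : (0 < n.*2.+2 < p)%N).
have := IH (ltac:(lia)); rewrite odd_even_prodS => ?; Zloc_tac.
Qed.

(** Odd j up to 2n+1 add 1/j to the slope and even j up to 2n subtract it, for a total of H_(2n+1) -
    H_n. *)
Lemma odd_even_prod_linear u n : eqmod_loc p p u 0 -> (n.*2.+1 < p)%N ->
  eqmod_loc p (p ^ 2) (odd_even_prod u n)
   (odd_even_prod (- p%:R) n *
     (1 + (u + p%:R) * (harmonic_number n.*2.+1 - harmonic_number n))).
Proof.
move=> hu np; have hp := eqmod_loc_p0.
have hNp : eqmod_loc p p (- p%:R) 0.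
  rewrite -sub0r -[X in eqmod_loc _ _ _ X]subr0; apply: eqmod_locB => //.
  exact/eqmod_loc_refl/rpred0.
have hv : eqmod_loc p p (u + p%:R) 0.
  by rewrite -[X in eqmod_loc _ _ _ X]addr0; apply: eqmod_locD.
have vZ : u + p%:R \in Zloc p by case/and3P: hv.
elim: n np => [|n IH] np.
  rewrite /odd_even_prod !big_ord0 !mulr1.
  have h1 : eqmod_loc p (p ^ 2) 1 (1 * (1 + (u + p%:R) * 0)).
    by rewrite mulr0 addr0 mulr1; exact/eqmod_loc_refl/rpred1.
  have := eqmod_lin_mul hv (rpred0 _) (prime_gt1 p_prime : (0 < 1 < p)%N) h1 (rpred1 _).
  have -> : harmonic_number 1 - harmonic_number 0 = 0 + 1%:R^-1.
    by rewrite harmonic_numberS harmonic_number0; field.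
  by have -> : 1 * (1 - p%:R + (u + p%:R)) = 1 + u by [ring]; rewrite mul1r.
have np' : (n.*2.+1 < p)%N by lia.
have j2 : (0 < n.*2.+2 < p)%N by lia.
have j3 : (0 < n.*2.+3 < p)%N by lia.
have {}IH := IH np'.
have YZ := Zloc_odd_even_prod hNp np'.
have EZ : harmonic_number n.*2.+1 - harmonic_number n \in Zloc p.
  by rewrite rpredB ?Zloc_harmonic //; lia.
have H1 := eqmod_lin_div hv EZ j2 IH YZ.
have Z2 := Zloc_natV j2.
have E2Z := rpredB EZ Z2.
have Y2Z : odd_even_prod (- p%:R) n / (n.*2.+2%:R - p%:R) \in Zloc p.
  have [_ cZ] := eqmod_loc_inv (eqmod_loc_subp n.*2.+2) j2.
  exact: rpredM.
have := eqmod_lin_mul hv E2Z j3 H1 Y2Z.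
have -> k : k - p%:R + (u + p%:R) = k + u by ring.
have -> k : k - p%:R + (u + p%:R) = k + u by ring.
rewrite -!odd_even_prodS doubleS !harmonic_numberS.
have -> : harmonic_number n.*2 + (n.*2.+1)%:R^-1 + (n.*2.+2)%:R^-1 + (n.*2.+3)%:R^-1 -
  (harmonic_number n + (n.+1)%:R^-1) =
  harmonic_number n.*2 + (n.*2.+1)%:R^-1 - harmonic_number n - (n.*2.+2)%:R^-1 +
  (n.*2.+3)%:R^-1; last by [].
have -> : n.+1%:R^-1 = 2 * n.*2.+2%:R^-1 :> rat; last by ring.
rewrite -[n.*2.+2]/(n.+1.*2) -mul2n natrM; field.
by rewrite nat1r pnatr_eq0.
Qed.

(** Up to sign, the numerators are the even numbers from 2m+2 to 2n+2m+2 and the denominators the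
    odd ones from 2m+3 to 2n+2m+1. This is a quotient of two Wallis products, except for the sign
    and the odd number 2m+1; both are supplied by 2n+2-x = -(2m+1). *)
Lemma odd_even_prodNp (n m : nat) (x : rat) : x = (n + m).+1.*2.+1%:R ->
  odd_even_prod (- x) n =
  (n.*2.+2%:R - x) * (4 ^+ (n + m).+1 / 'C((n + m).+1.*2, (n + m).+1)%:R)
   * ('C(m.*2, m)%:R / 4 ^+ m).
Proof.
have dbl k : k.*2%:R = 2 * k%:R :> rat by rewrite -mul2n natrM.
have S1 k : k.+1%:R = k%:R + 1 :> rat by rewrite natr1.
elim: n m => [|n IH] m hx; have h0 := central_bin_neq0 m;
  have m0 : 0 <= m%:R :> rat by rewrite ler0n.
  rewrite hx add0n /odd_even_prod big_ord0 central_binS exprS.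
  rewrite !(S1 _.*2.+1) !(S1 _.*2) !dbl !S1.
  have q0 : 4 ^+ m != 0 :> rat by rewrite expf_neq0.
  by field; rewrite h0 q0 !lt0r_neq0 //; lra.
have n0 : 0 <= n%:R :> rat by rewrite ler0n.
have q0 : 4 ^+ m != 0 :> rat by rewrite expf_neq0.
(* Lowering n while raising m keeps n + m, hence [x], fixed. *)
rewrite odd_even_prodS (IH m.+1) ?addnS // addSn hx.
move: (4 ^+ _.+2 / _) => K; rewrite central_binS exprS.
rewrite !(S1 _.*2.+2) !(S1 _.*2.+1) !(S1 _.*2) !dbl !S1 !natrD.
field; repeat (apply/andP; split) => //;
  [apply: ltr0_neq0; lra | apply: lt0r_neq0; lra].
Qed.

(** * Odd residues: evaluation of the sum *)

Lemma morley_inverse :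
  eqmod_loc p (p ^ 2) (4 ^+ h / 'C(h.*2, h)%:R)
    ((-1) ^+ h * 4 ^+ h * (1 - 2 * p%:R * fermat_quotient2 p)).
Proof.
have qZ := Zloc_fermat_quotient2; set q := fermat_quotient2 p in qZ *.
have C0 := central_bin_neq0 h.
have KZ : 4 ^+ h / 'C(h.*2, h)%:R \in Zloc p.
  (* As a Wallis product, this quotient has only the denominators 2i+1 < p. *)
  rewrite -prod_even_odd rpred_prod // => i _.
  have il : (0 < i.*2.+1 < p)%N by have := ltn_ord i; lia.
  by have := Zloc_natV il => ?; Zloc_tac.
set C := 'C(_, _)%:R in C0 KZ *; set K := _ / C in KZ *.
(* Morley's congruence is multiplied by this element: its left side becomes the target, and its
   right side becomes [K] modulo p^2 because 4^h = 1 + pq and (1 - 2pq)(1 + pq)^2 is 1 modulo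
   p^2. *)
have sZ : (-1) ^+ h * (1 - 2 * p%:R * q) * K \in Zloc p by Zloc_tac.
have := eqmod_locM (eqmod_loc_refl _ sZ) central_bin_pred_prime.
have -> : (-1) ^+ h * (1 - 2 * p%:R * q) * K * C =
    (-1) ^+ h * 4 ^+ h * (1 - 2 * p%:R * q) by rewrite /K; field.
move=> h1; apply/eqmod_loc_sym/(eqmod_loc_trans h1).
have s2 : (-1) ^+ h * (-1) ^+ h = 1 :> rat by rewrite -expr2 sqrr_sign.
apply: eqmod_loc_sub0; try Zloc_tac.
have -> : (-1) ^+ h * (1 - 2 * p%:R * q) * K * ((-1) ^+ h * (4 ^+ h) ^+ 2) - K =
   ((-1) ^+ h * (-1) ^+ h) * ((1 - 2 * p%:R * q) * (4 ^+ h) ^+ 2 - 1) * K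
   + ((-1) ^+ h * (-1) ^+ h - 1) * K by ring.
rewrite s2 pow4_half -/q.
have -> : 1 * ((1 - 2 * p%:R * q) * (1 + p%:R * q) ^+ 2 - 1) * K + (1 - 1) * K =
   p%:R * p%:R * (- (q * q * (3 + 2 * p%:R * q)) * K) by ring.
by apply: eqmod_loc0M2; try exact: eqmod_loc_p0; Zloc_tac.
Qed.

Lemma alt_sum_odd u n m : eqmod_loc p p u 0 -> (h = (n + m).+1)%N ->
  eqmod_loc p (p ^ 2) (alt_sum (1 + u + n.*2%:R))
    ((u + n.*2.+2%:R) * (-1) ^+ m.+1 * 2 ^+ (4 * n + 3) * 'C(m.*2, m)%:R *
      (1 - 2 * p%:R * fermat_quotient2 p + (u + p%:R) *
        (harmonic_number n.*2.+2 - harmonic_number n.+1))).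
Proof.
move=> hu hnm.
have hv : eqmod_loc p p (u + p%:R) 0.
  rewrite -[X in eqmod_loc _ _ _ X]addr0; apply: eqmod_locD => //; exact: eqmod_loc_p0.
have np : (n.*2.+2 < p)%N by lia.
have np1 : (n.*2.+1 < p)%N by lia.
have np2 : (1 + n.*2 < p)%N by lia.
have np3 : (n.+1 < p)%N by lia.
have np4 : (0 < n.*2.+2 < p)%N by lia.
have uZ : u \in Zloc p by case/and3P: hu.
have qZ := Zloc_fermat_quotient2; set q := fermat_quotient2 p in qZ *.
have h1 : eqmod_loc p p (1 + u) 1%:R.
  rewrite -[X in eqmod_loc _ _ _ X]addr0; apply/eqmod_locD => //.
  exact/eqmod_loc_refl/rpred1.
set v := u + p%:R in hv *; set E := harmonic_number _ - _.
have vZ : v \in Zloc p by case/and3P: hv.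
have EZ : E \in Zloc p by rewrite rpredB ?Zloc_harmonic.
have jZ := Zloc_natV np4.
have jZ2 := Zloc_natV (np3 : (0 < n.+1 < p)%N).
apply: eqmod_loc_trans (alt_sum_iter h1 np2) _.
set P := \prod_(i < n) _.
have cZ : (- 4) ^+ n * P \in Zloc p.
  rewrite rpredM ?rpredX ?rpredN ?Zloc_nat // rpred_prod // => i _.
  have il : (0 < 1 + i.*2.+1 < p)%N by move: (ltn_ord i) np2; clear; lia.
  have [_ iZ] := eqmod_loc_inv (eqmod_locDnat i.*2.+1 h1) il.
  by Zloc_tac.
apply: eqmod_loc_trans (eqmod_locM (eqmod_loc_refl _ cZ) (alt_sum1 hu)) _.
have -> : (- 4) ^+ n * P * (2 * (1 + u)) = 2 * (- 4) ^+ n * odd_even_prod u n.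
  by rewrite /odd_even_prod -/P; ring.
have kZ : 2 * (- 4) ^+ n \in Zloc p by Zloc_tac.
apply: eqmod_loc_trans (eqmod_locM (eqmod_loc_refl _ kZ) (odd_even_prod_linear hu np1)) _.
(* The excess 1/(2n+2) over the wanted slope is what turns the factor 2n+2-p of the constant term
   into u+2n+2, by [eqmod_lin_mul] with j = 2n+2. *)
have eE : harmonic_number n.*2.+1 - harmonic_number n = E + n.*2.+2%:R^-1.
  rewrite /E [harmonic_number n.*2.+2]harmonic_numberS [harmonic_number n.+1]harmonic_numberS.
  have -> : n.+1%:R^-1 = 2 * n.*2.+2%:R^-1 :> rat; last by ring.
  rewrite -[n.*2.+2]/(n.+1.*2) -mul2n natrM; field.
  by rewrite nat1r pnatr_eq0.
rewrite eE -/v (odd_even_prodNp (n := n) (m := m)) -?hnm -?pE //.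
have hX : eqmod_loc p (p ^ 2) (1 + v * E) (1 * (1 + v * E)).
  by rewrite mul1r; apply: eqmod_loc_refl; Zloc_tac.
have := eqmod_lin_mul hv EZ np4 hX (rpred1 _).
have -> : n.*2.+2%:R - p%:R + v = u + n.*2.+2%:R by rewrite /v; ring.
rewrite mul1r => /eqmod_loc_sym h2.
set K := 4 ^+ h / _; set C := 'C(m.*2, m)%:R.
have m4Z : (4 ^+ m)^-1 \in Zloc p.
  have -> : (4 ^+ m)^-1 = (2^-1 ^+ m) ^+ 2 :> rat.
    rewrite -!exprM mulnC exprM -exprVn; congr (_ ^+ _); by field.
  by have := Zloc_half => ?; Zloc_tac.
have CZ : C \in Zloc p by exact: Zloc_nat.
have KZ : K \in Zloc p by case/and3P: morley_inverse.
have lZ : 2 * (- 4) ^+ n * (C / 4 ^+ m) \in Zloc p by Zloc_tac.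
have -> : 2 * (- 4) ^+ n * ((n.*2.+2%:R - p%:R) * K * (C / 4 ^+ m) *
    (1 + v * (E + n.*2.+2%:R^-1))) =
  2 * (- 4) ^+ n * (C / 4 ^+ m) *
    (K * ((n.*2.+2%:R - p%:R) * (1 + v * (E + n.*2.+2%:R^-1)))) by ring.
apply: eqmod_loc_trans (eqmod_locM (eqmod_loc_refl _ lZ) (eqmod_locM morley_inverse h2)) _.
rewrite -/q.
(* Since h = n+m+1, the powers combine to 2 4^(n+h-m) = 2^(4n+3) and the signs to (-1)^(n+h) =
   (-1)^(m+1). *)
have -> : 2 * (- 4) ^+ n * (C / 4 ^+ m) *
   ((-1) ^+ h * 4 ^+ h * (1 - 2 * p%:R * q) * ((1 + v * E) * (u + n.*2.+2%:R))) =
  (u + n.*2.+2%:R) * (-1) ^+ m.+1 * 2 ^+ (4 * n + 3) * C *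
     ((1 - 2 * p%:R * q) * (1 + v * E)).
  have s2 : (-1) ^+ n * (-1) ^+ n = 1 :> rat by rewrite -expr2 sqrr_sign.
  have -> : 2 ^+ (4 * n + 3) = 8 * (4 ^+ n * 4 ^+ n) :> rat.
    rewrite exprD exprM -exprMn; have -> : 2 ^+ 4 = 4 * 4 :> rat by ring.
    by ring.
  rewrite hnm !(exprS _ (n + m)) (exprS _ m) !exprD -[- 4]mulN1r !exprMn.
  move: s2; set s := (-1) ^+ n => s2.
  rewrite -[RHS]mul1r -[X in _ = X * _]s2; field.
  by rewrite expf_neq0.
apply: eqmod_locM; first by apply: eqmod_loc_refl; Zloc_tac.
(* Both corrections are multiples of p, so their cross term vanishes modulo p^2 and the product
   becomes a sum. *)
apply: eqmod_loc_sub0; try Zloc_tac.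
have -> : (1 - 2 * p%:R * q) * (1 + v * E) - (1 - 2 * p%:R * q + v * E) =
  p%:R * v * (- 2 * q * E) by ring.
by apply: eqmod_loc0M2; rewrite ?eqmod_loc_p0 //; Zloc_tac.
Qed.

End Localization.

(** * The two parities of the residue, with u = a - r *)

Theorem theorem3p3 (p : nat) (a : rat) (p_prime : prime p) (p_odd : odd p)
    (aZp : a \in Zloc p)
    (a_neq0 : ~~ eqmod_loc p p a 0) (a_neqN1 : ~~ eqmod_loc p p a (-1)) :
  let r := residue p a in
  (~~ odd r ->
    eqmod_loc p (p ^ 2)
      (\sum_(0 <= k < p) gbin a k ^+ 2 * (-1) ^+ k * (1 - 2 / a * k%:R))
      ((-1) ^+ (r./2) * 2 ^+ (2 * r)
         * ((a - r%:R) / (a * ('C(r, r./2))%:R))))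
  /\
  (odd r ->
    eqmod_loc p (p ^ 2)
      (\sum_(0 <= k < p) gbin a k ^+ 2 * (-1) ^+ k * (1 - 2 / a * k%:R))
      ((a + 1) / a * (-1) ^+ ((p - r)./2) * 2 ^+ (2 * r + 1)
         * ('C(p - 2 - r, (p - 2 - r)./2))%:R
         * (1 - 2 * p%:R * fermat_quotient2 p
            + (p%:R + a - r%:R)
              * (harmonic_number r.+1 - harmonic_number (r.+1)./2)))).
Proof.
move=> r.
have [rp har] : (r < p)%N /\ eqmod_loc p p a r%:R := residueP p_prime aZp.
clearbody r.
have aVZ := Zloc_inv p_prime aZp a_neq0.
have a0 : a != 0.
  by apply: contraNneq a_neq0 => ->; apply/eqmod_loc_refl/rpred0.
have -> : \sum_(0 <= k < p) gbin a k ^+ 2 * (-1) ^+ k * (1 - 2 / a * k%:R) =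
    a^-1 * alt_sum p a.
  rewrite /alt_sum mulr_sumr; apply: eq_bigr => k _; rewrite /alt_term.
  by field.
have hu : eqmod_loc p p (a - r%:R) 0.
  by rewrite -(subrr r%:R); apply: eqmod_locB => //; apply/eqmod_loc_refl/Zloc_nat.
have hV := eqmod_loc_refl p_prime (p ^ 2) aVZ.
split=> [r_even|r_odd].
  have er : r = r./2.*2 by rewrite even_halfK.
  move: r./2 er => n er.
  have np : (n.*2 < p)%N by rewrite -er.
  have := eqmod_locM p_prime hV (alt_sum_even p_prime hu np).
  rewrite -er subrK mulnC.
  have -> : (2 * r = n * 4)%N by rewrite er; clear; lia.
  set C := 'C(_, _)%:R => H.
  have -> : (-1) ^+ n * 2 ^+ (n * 4) * ((a - r%:R) / (a * C)) =
     a^-1 * ((-1) ^+ n * 2 ^+ (n * 4) * ((a - r%:R) / C)).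
    by rewrite invfM; ring.
  exact: H.
have [n er] : exists n, r = n.*2.+1 by exists r./2; move: r_odd; clear; lia.
(* As p and r are odd with r < p, p - 2 - r is a natural even number 2m, and (p-1)/2 = n+m+1. *)
have [m em] : exists m, p = (n + m).+1.*2.+1.
  by exists ((p - 2 - r)./2); move: rp p_odd er; clear; lia.
have := eqmod_locM p_prime hV (alt_sum_odd p_prime em hu erefl).
have -> : 1 + (a - r%:R) + n.*2%:R = a by rewrite er -natr1; ring.
have -> : a - r%:R + n.*2.+2%:R = a + 1 by rewrite er -!natr1; ring.
have -> : (p - r)./2 = m.+1 by move: er em; clear; lia.
have -> : (p - 2 - r)./2 = m by move: er em; clear; lia.
have -> : (p - 2 - r = m.*2)%N by move: er em; clear; lia.
have -> : (2 * r + 1 = 4 * n + 3)%N by move: er em; clear; lia.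
have -> : r.+1./2 = n.+1 by move: er em; clear; lia.
have -> : r.+1 = n.*2.+2 by move: er em; clear; lia.
have -> : a - r%:R + p%:R = p%:R + a - r%:R by ring.
by rewrite [(a + 1) / a]mulrC !mulrA.
Qed.
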